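(* Let $J$ be the maximal block Jacobi operator and let $\varphi_j:=\delta_0(e_j)$ for $j=1,\dots,d$. Then the system $\vec\varphi=(\varphi_1,\dots,\varphi_d)$ is a cyclic system for $J$.
   Context: Let $d\in\mathbb{N}$, $\mathbb{N}_0=\{0,1,2,\dots\}$, and let $(A_n)_{n\ge0},(B_n)_{n\ge 0}$ be sequences in $M_d(\mathbb{C})$ with $\det A_n\ne0$ and $B_n=B_n^*$ for all $n\ge0$. The formal block Jacobi operator acts on all sequences $u=(u_n)_{n\ge0}$ in $\mathbb{C}^d$ by $(\mathcal{J}u)_0=B_0u_0+A_0u_1$, $(\mathcal{J}u)_n=A_{n-1}^*u_{n-1}+B_nu_n+A_nu_{n+1}$ for $n\ge1$. The maximal block Jacobi operator $J$ in the Hilbert space $\ell^2(\mathbb{N}_0,\mathbb{C}^d)$ is the restriction of $\mathcal{J}$ to $\mathrm{Dom}(J)=\{u\in\ell^2(\mathbb{N}_0,\mathbb{C}^d):\mathcal{J}u\in\ell^2(\mathbb{N}_0,\mathbb{C}^d)\}$. (It is not assumed self-adjoint.) $e_1,\dots,e_d$ is the standard basis of $\mathbb{C}^d$; for $v\in\mathbb{C}^d$, $\delta_0(v)$ is the sequence with $v$ at position $0$ and $0$ elsewhere. $\mathrm{Dom}(J^\infty)=\bigcap_{n\in\mathbb{N}}\mathrm{Dom}(J^n)$. A system $(\varphi_1,\dots,\varphi_k)$ of vectors is a cyclic system for $J$ iff all $\varphi_j\in\mathrm{Dom}(J^\infty)$ and the linear span of $\{J^n\varphi_j:n\in\mathbb{N}_0,\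 j=1,\dots,k\}$ is dense in $\ell^2(\mathbb{N}_0,\mathbb{C}^d)$. *)

(* Defs.v *)
From HB Require Import structures.
From mathcomp Require Import all_boot all_order all_algebra spectral.
From mathcomp Require Import complex.
From mathcomp Require Import all_classical all_reals all_analysis.

Set Implicit Arguments.
Unset Strict Implicit.
Unset Printing Implicit Defensive.

Import Order.TTheory GRing.Theory Num.Theory.

Local Open Scope classical_set_scope.
Local Open Scope ring_scope.
Local Open Scope sesquilinear_scope.

(* Sequences (u_n) with n >= 0 and values in C^d, where C = R[i]; C^d consists
   of column vectors so that matrices act from the left. *)
Notation vseq R d := (nat -> 'cV[R[i]]_d).

(* Euclidean norm: the library norm on matrices is the sup norm. *)
Definition euclid_norm (R : realType) (d : nat) (v : 'cV[R[i]]_d) : R :=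
  Num.sqrt (\sum_(i < d) ComplexField.Normc.normc (v i 0) ^+ 2).

Definition l2norm (R : realType) (d : nat) (u : vseq R d) : \bar R :=
  sqrte (\sum_(0 <= n <oo) (euclid_norm (u n) ^+ 2)%:E)%E.

Definition l2 (R : realType) (d : nat) : set (vseq R d) :=
  [set u | (l2norm u < +oo)%E].

Definition l2_dense (R : realType) (d : nat) (S : set (vseq R d)) : Prop :=
  forall u, l2 u -> forall eps : R, 0 < eps ->
    exists2 v, S v & (l2norm (u - v)%R < eps%:E)%E.

Definition lin_span (K : pzRingType) (V : lmodType K) (S : set V) : set V :=
  [set v | exists (m : nat) (c : 'I_m -> K) (w : 'I_m -> V),
    (forall i, S (w i)) /\ v = \sum_(i < m) c i *: w i].

(* A partially defined operator; values of [app] outside [dom] are irrelevant. *)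
Record partial_op (V : Type) := PartialOp { dom : set V; app : V -> V }.

(* Powers of an operator in l2: T^0 is the identity on all of l2, and
   Dom(T^(n+1)) is the set of u in Dom(T^n) such that T^n u is in Dom(T). *)
Fixpoint op_pow (R : realType) (d : nat) (T : partial_op (vseq R d)) (n : nat) :
    partial_op (vseq R d) :=
  match n with
  | 0%N => PartialOp (@l2 R d) id
  | m.+1 => PartialOp
      [set u | dom (op_pow T m) u /\ dom T (app (op_pow T m) u)]
      (fun u => app T (app (op_pow T m) u))
  end.

Definition dom_infty (R : realType) (d : nat) (T : partial_op (vseq R d)) :
    set (vseq R d) :=
  \bigcap_(n in [set: nat]) dom (op_pow T n).

Definition cyclic_system (R : realType) (d : nat) (T : partial_op (vseq R d))
    (k : nat) (phi : 'I_k -> vseq R d) : Prop :=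
  (forall j, dom_infty T (phi j)) /\
  l2_dense (lin_span
    [set v | exists (n : nat) (j : 'I_k), v = app (op_pow T n) (phi j)]).

Definition formal_jacobi (R : realType) (d : nat) (A B : nat -> 'M[R[i]]_d)
    (u : vseq R d) : vseq R d :=
  fun n => match n with
  | 0%N => B 0%N *m u 0%N + A 0%N *m u 1%N
  | m.+1 => (A m)^t* *m u m + B m.+1 *m u m.+1 + A m.+1 *m u m.+2
  end.

Definition max_jacobi (R : realType) (d : nat) (A B : nat -> 'M[R[i]]_d) :
    partial_op (vseq R d) :=
  PartialOp [set u | l2 u /\ l2 (formal_jacobi A B u)] (formal_jacobi A B).

Definition delta0 (R : realType) (d : nat) (v : 'cV[R[i]]_d) : vseq R d :=
  fun n => if n == 0%N then v else 0.

(* Main.v *)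
Require Import Defs.
From HB Require Import structures.
From mathcomp Require Import all_boot all_order all_algebra spectral.
From mathcomp Require Import complex.
From mathcomp Require Import all_classical all_reals all_analysis.

(** The idea: write [J] for the Jacobi operator.  It is linear and enlarges the
    support of a sequence by at most one site, so finitely supported sequences
    are stable under [J]; being square summable, they lie in the domain of
    every power of [J].  This covers the membership of the [delta0 e_j] in
    [dom_infty].

    For the cyclicity, the span of the orbits [J^n (delta0 e_j)] is a
    [J]-stable subspace.  It contains all sequences supported at site [0].
    If [w] is supported on sites [0..n], the entry of [J w] at the site [n.+1]
    is [(A n)^* w_n], and [(A n)^*] is invertible; hence any [u] supported on
    [0..n.+1] agrees at [n.+1] with [J w] for a suitable [w] supported on
    [0..n], and [u - J w] is supported on [0..n] again.  By induction the span
    contains every finitely supported sequence ([span_supported]), and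
    truncation shows that these are dense ([truncate_approx]). *)

Set Implicit Arguments.
Unset Strict Implicit.

Import Order.TTheory GRing.Theory Num.Theory.
Local Open Scope ring_scope.
Local Open Scope sesquilinear_scope.

Section LinearSpan.
Variables (K : pzRingType) (V : lmodType K) (S : set V).

Lemma lin_spanD (u v : V) :
  lin_span S u -> lin_span S v -> lin_span S (u + v).
Proof.
move=> [m [c [w [Sw ->]]]] [m' [c' [w' [Sw' ->]]]].
exists (m + m')%N.
exists (fun i => match fintype.split i with inl j => c j | inr j => c' j end).
exists (fun i => match fintype.split i with inl j => w j | inr j => w' j end).
split; first by move=> i; case: fintype.split.
rewrite big_split_ord /=; congr (_ + _); apply: eq_bigr => i _.
  by rewrite (unsplitK (inl i)).
by rewrite (unsplitK (inr i)).
Qed.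

Lemma lin_span_stable (f : {linear V -> V}) :
  (forall v, S v -> S (f v)) -> forall v, lin_span S v -> lin_span S (f v).
Proof.
move=> fS v [m [c [w [Sw ->]]]].
exists m, c, (fun i => f (w i)); split; first by move=> i; apply: fS.
by rewrite linear_sum; apply: eq_bigr => i _; rewrite linearZ.
Qed.

End LinearSpan.

Section SquareSummable.
Variables (R : realType) (d : nat).
Implicit Type u : nat -> 'cV[R[i]]_d.

Local Notation term u := (fun n => (euclid_norm (u n) ^+ 2)%:E).

Definition supported (n : nat) u := forall k, (n < k)%N -> u k = 0.

Definition truncate (N : nat) u : nat -> 'cV[R[i]]_d :=
  fun n => if (n < N)%N then u n else 0.

Lemma euclid_norm0 : euclid_norm (0 : 'cV[R[i]]_d) = 0.
Proof.
rewrite /euclid_norm big1 ?sqrtr0 // => i _.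
by rewrite mxE /= !expr0n /= addr0 sqrtr0 expr0n.
Qed.

Lemma term_ge0 u n : (0 <= term u n)%E.
Proof. by rewrite lee_fin sqr_ge0. Qed.

Lemma l2E u : l2 u <-> (\sum_(0 <= n <oo) term u n < +oo)%E.
Proof.
rewrite /l2 /l2norm /=.
have : (0 <= \sum_(0 <= n <oo) term u n)%E.
  by apply: nneseries_ge0 => n _ _; apply: term_ge0.
by case: (\sum_(0 <= n <oo) _)%E => //= r; rewrite !ltry.
Qed.

Lemma supported_l2 n u : supported n u -> l2 u.
Proof.
move=> su; apply/l2E.
rewrite (nneseries_split 0 n.+1); last by move=> k _; apply: term_ge0.
rewrite add0n [X in (_ + X)%E]eseries0; last first.
  by move=> k nk _; rewrite su // euclid_norm0 expr0n.
by rewrite adde0 sumEFin ltry.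
Qed.

(** The error of truncating at [N] is the tail of a convergent series. *)
Lemma truncate_approx u (eps : R) : l2 u -> 0 < eps ->
  exists N, (l2norm (u - truncate N u)%R < eps%:E)%E.
Proof.
move=> /l2E lu e0.
have : (\forall N \near \oo, \sum_(N <= k <oo) term u k < (eps ^+ 2)%:E)%classic%E.
  apply: (@nneseries_tail_cvg R (term u) xpredT lu (fun k _ => term_ge0 u k)
    [set y | y < (eps ^+ 2)%:E]%classic%E).
  apply: open_nbhs_nbhs; split; first exact: open_ereal_lt_ereal.
  by rewrite /= lte_fin exprn_gt0.
case=> N _ /(_ N (leqnn N)) /= tail; exists N.
have -> : l2norm (u - truncate N u)%R = sqrte (\sum_(N <= k <oo) term u k)%E.
  rewrite /l2norm (nneseries_split 0 N); last first.
    by move=> k _; apply: (term_ge0 (u - truncate N u)).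
  rewrite add0n big_nat big1 ?add0e; last first.
    move=> k /andP[_ kN]; rewrite !fctE /truncate.
    by rewrite kN subrr euclid_norm0 expr0n.
  congr sqrte; rewrite eseries_cond [RHS]eseries_cond.
  apply: eq_eseriesr => k /= Nk.
  by rewrite !fctE /truncate ltnNge Nk /= subr0.
rewrite ltNge; apply/negP => le_eps.
have : (sqrte (eps ^+ 2)%:E <= sqrte (\sum_(N <= k <oo) term u k))%E.
  by rewrite /= sqrtr_sqr gtr0_norm.
rewrite lee_sqrt; last by apply: nneseries_ge0 => k _ _; apply: term_ge0.
by rewrite leNgt tail.
Qed.

End SquareSummable.

Section Jacobi.
Variables (R : realType) (d : nat) (A B : nat -> 'M[R[i]]_d).
Local Notation J := (formal_jacobi A B).
Local Notation V := (nat -> 'cV[R[i]]_d).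

Fact formal_jacobi_is_linear : linear (J : V -> V).
Proof.
have scaleDACA (a : R[i]) (x x' y y' : 'cV[R[i]]_d) :
    (a *: x + y) + (a *: x' + y') = a *: (x + x') + (y + y').
  by rewrite scalerDr addrACA.
move=> a u v; apply/funext => -[|n]; rewrite !fctE /= !mulmxDr -!scalemxAr.
  exact: scaleDACA.
by rewrite scaleDACA; exact: scaleDACA.
Qed.

HB.instance Definition _ :=
  GRing.isLinear.Build R[i] V V _ J formal_jacobi_is_linear.

Lemma formal_jacobi_supported n (u : V) : supported n u -> supported n.+1 (J u).
Proof.
move=> su [//|k]; rewrite ltnS => nk /=.
by rewrite !su ?mulmx0 ?addr0 // ltnW // ltnW.
Qed.

Lemma op_pow_supported n (u : V) m : supported n u ->
  dom (op_pow (max_jacobi A B) m) u /\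
  supported (n + m) (app (op_pow (max_jacobi A B) m) u).
Proof.
move=> su; elim: m => [|m [domu sm]] /=.
  by rewrite addn0; split=> //; apply: supported_l2 su.
have sJ := formal_jacobi_supported sm.
by rewrite addnS; split=> //; do 2!split=> //; apply: supported_l2; eassumption.
Qed.

Lemma delta0_supported (v : 'cV[R[i]]_d) : supported 0 (delta0 v).
Proof. by case. Qed.

Definition orbits : set V := [set v | exists (n : nat) (j : 'I_d),
  v = app (op_pow (max_jacobi A B) n) (delta0 (delta_mx j 0))]%classic.

Lemma span_orbits_jacobi (u : V) : lin_span orbits u -> lin_span orbits (J u).
Proof.
apply: lin_span_stable => v [n [j ->]].
by exists n.+1, j.
Qed.

Lemma span_orbits_site0 (u : V) : supported 0 u -> lin_span orbits u.
Proof.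
move=> su; exists d, (fun j => u 0%N j 0), (fun j => delta0 (delta_mx j 0)).
split=> [j|]; first by exists 0%N, j.
apply/funext => -[|n]; rewrite fct_sumE; last first.
  by rewrite su // big1 // => i _; rewrite !fctE /delta0 /= scaler0.
rewrite [LHS]matrix_sum_delta; apply: eq_bigr => i _.
by rewrite big_ord1 !fctE.
Qed.

(** Induction on [n]: subtracting a suitable vector [J w] of the span kills
    the last entry of [u] without enlarging its support. *)
Lemma span_supported n (u : V) : (forall k : nat, \det (A k) != 0) ->
  supported n u -> lin_span orbits u.
Proof.
move=> hA; elim: n u => [|n IH] u su; first exact: span_orbits_site0.
have uA : (A n)^t* \in unitmx.
  by rewrite map_unitmx unitmx_tr unitmxE unitfE.
(* [w] solves [(A n)^* w_n = u_(n+1)] and sits at the single site [n], so that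
   the entry of [J w] at [n.+1] is the one of [u]. *)
pose w : V := fun k => if k == n then invmx ((A n)^t*) *m u n.+1 else 0.
have sw : supported n w by move=> k nk; rewrite /w gtn_eqF.
have Jw_last : J w n.+1 = u n.+1.
  by rewrite /= (sw n.+1) // (sw n.+2) // !mulmx0 !addr0 /w eqxx mulKVmx.
rewrite -(subrK (J w) u); apply: lin_spanD; last exact/span_orbits_jacobi/IH.
apply: IH => k; rewrite leq_eqVlt !fctE => /predU1P[<-|nk].
  by rewrite Jw_last subrr.
by rewrite su // (formal_jacobi_supported sw) // subr0.
Qed.

End Jacobi.

Theorem proposition3p2 (R : realType) (d : nat) (A B : nat -> 'M[R[i]]_d)
    (hd : (0 < d)%N)
    (hA : forall n : nat, \det (A n) != 0)
    (hB : forall n : nat, B n = (B n)^t*) :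
  cyclic_system (max_jacobi A B)
    (fun j : 'I_d => delta0 (delta_mx j 0 : 'cV[R[i]]_d)).
Proof.
split=> [j n _|u lu eps e0].
  by case: (op_pow_supported A B n (delta0_supported (delta_mx j 0))).
have [N lN] := truncate_approx lu e0.
exists (truncate N u) => //.
apply: (@span_supported _ _ A B N) => // k Nk.
by rewrite /truncate ltnNge ltnW.
Qed.
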